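(* Let $\epsilon,\delta,\alpha\in(0,1)$. Consider the following dynamic trace estimation problem: $A_1,\dots,A_m$ are real $n\times n$ matrices satisfying $\|A_i\|_*\le 1$ for all $i\in\{1,\dots,m\}$ and $\|A_{i+1}-A_i\|_*\le\alpha$ for all $i\in\{1,\dots,m-1\}$; they can be accessed only through matrix-vector products, in sequence; the goal is to output numbers $t_1,\dots,t_m$ such that for every $i$, $\Pr[|t_i-\mathrm{tr}(A_i)|\ge\epsilon]\le\delta$. Then the DeltaShift++ algorithm (described in the context), run with $\ell_0=O(\sqrt{1/\delta}/\epsilon)$, $\ell=O(\sqrt{\alpha/\delta}/\epsilon)$ (for suitable absolute constants) and $\gamma=\alpha$, solves this problem, using in total $$O\!\left(m\cdot\frac{\sqrt{\alpha/\delta}}{\epsilon}+\frac{\sqrt{1/\delta}}{\epsilon}\right)$$ matrix-vector multiplications with $A_1,\dots,A_m$.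
   Context: $\|B\|_*=\sum_k\sigma_k(B)$ denotes the nuclear norm (sum of singular values). For a square matrix $B\in\mathbb{R}^{n\times n}$ and a positive integer $\ell$ divisible by $3$, the Hutch++ estimator $h^{++}_\ell(B)$ (of Meyer, Musco, Musco, Woodruff) is computed with $\ell$ matrix-vector products with $B$ as follows: draw independent Rademacher ($\pm1$ i.i.d. entries) matrices $S,G\in\mathbb{R}^{n\times \ell/3}$; let $Q$ be a matrix whose columns form an orthonormal basis of the column span of $BS$; output $$h^{++}_\ell(B)=\mathrm{tr}(Q^TBQ)+\frac{3}{\ell}\mathrm{tr}\big(G^T(I-QQ^T)B(I-QQ^T)G\big).$$ When $B=A_j-A_{j-1}$, matrix-vector products with $B$ are computed via products with $A_j$ and $A_{j-1}$. The DeltaShift++ algorithm with inputs positive integers $\ell_0,\ell$ and damping factor $\gamma\in[0,1]$ sets $t_1=h^{++}_{\ell_0}(A_1)$ and, for $j=2,\dots,m$, $$t_j=\gamma\,h^{++}_\ell(A_j)+(1-\gamma)\big(t_{j-1}+h^{++}_\ell(A_j-A_{j-1})\big),$$ where every invocation of $h^{++}$ uses fresh independent randomness.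
   Formalization: Since ℓ must be a positive multiple of 3, ℓ is rounded up to 3⌈c·x⌉ with x=√(α/δ)/ε, and the total is bounded by O(m·max(1,x)+√(1/δ)/ε); the literal O(m·x+√(1/δ)/ε) fails when x is small (e.g. α=1/m²). *)

(* Defs.v *)
From HB Require Import structures.
From mathcomp Require Import all_boot all_order all_algebra.
From mathcomp Require Import polyrcf.
From mathcomp Require Import boolp reals.

Set Implicit Arguments.
Unset Strict Implicit.
Unset Printing Implicit Defensive.

Import Order.TTheory GRing.Theory Num.Theory.
Local Open Scope ring_scope.

(* Square roots of the roots of the characteristic polynomial of B^T B, each
   repeated with its multiplicity. *)
Definition singular_values (R : realType) (n : nat) (B : 'M[R]_n) : seq R :=
  let p := char_poly (B^T *m B) in
  flatten [seq nseq (mup x p) (Num.sqrt x) | x <- rootsR p].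

Definition nuclear_norm (R : realType) (n : nat) (B : 'M[R]_n) : R :=
  \sum_(s <- singular_values B) s.

(* Randomized algorithms whose only access to a sequence A_1, A_2, ... of n x n
   matrices is the evaluation of products A_i v: [MatVec i v k] continues as
   k (A_i v), and [Rademacher q k] continues as k S for a fresh n x q matrix S
   of independent uniform signs. *)
Inductive alg (R : realType) (n : nat) (X : Type) : Type :=
| Ret of X
| Rademacher (q : nat) of ('M[R]_(n, q) -> alg R n X)
| MatVec (i : nat) (v : 'cV[R]_n) of ('cV[R]_n -> alg R n X).

Arguments Ret {R n X} _.
Arguments Rademacher {R n X} q _.
Arguments MatVec {R n X} i v _.

Fixpoint bind (R : realType) (n : nat) (X Y : Type) (p : alg R n X)
    (f : X -> alg R n Y) {struct p} : alg R n Y :=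
  match p with
  | Ret x => f x
  | Rademacher q k => Rademacher q (fun S => bind (k S) f)
  | MatVec i v k => MatVec i v (fun w => bind (k w) f)
  end.

Notation "'let*' x ':=' p 'in' q" := (bind p (fun x => q))
  (at level 200, x name, p at level 100, q at level 200).

Definition sign_mx (R : realType) (n q : nat) (S : 'M[bool]_(n, q)) :
  'M[R]_(n, q) := map_mx (fun b : bool => (-1) ^+ b) S.

(* Probability that the output satisfies E: every Rademacher matrix is uniform
   over all sign matrices, independently of what happened before. *)
Fixpoint Pr (R : realType) (n : nat) (X : Type) (A : nat -> 'M[R]_n)
    (p : alg R n X) (E : X -> bool) {struct p} : R :=
  match p with
  | Ret x => (E x)%:R
  | Rademacher q k =>
      (\sum_(S : 'M[bool]_(n, q)) Pr A (k (sign_mx R S)) E)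
        / #|{: 'M[bool]_(n, q)}|%:R
  | MatVec i v k => Pr A (k (A i *m v)) E
  end.

(* Number of matrix-vector products, in the worst case over the signs. *)
Fixpoint num_matvec (R : realType) (n : nat) (X : Type) (A : nat -> 'M[R]_n)
    (p : alg R n X) {struct p} : nat :=
  match p with
  | Ret _ => 0%N
  | Rademacher q k => (\max_(S : 'M[bool]_(n, q)) num_matvec A (k (sign_mx R S)))%N
  | MatVec i v k => (num_matvec A (k (A i *m v))).+1
  end.

(* A way of computing products B v, for some n x n matrix B. *)
Definition oracle (R : realType) (n : nat) := 'cV[R]_n -> alg R n 'cV[R]_n.

Definition orc (R : realType) (n : nat) (i : nat) : oracle R n :=
  fun v => MatVec i v (fun w => Ret w).

Definition orc_diff (R : realType) (n : nat) (i j : nat) : oracle R n :=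
  fun v => let* x := orc i v in let* y := orc j v in Ret (x - y).

(* B V, column by column. *)
Fixpoint matmul (R : realType) (n : nat) (B : oracle R n) (q : nat) :
    'M[R]_(n, q) -> alg R n 'M[R]_(n, q) :=
  match q return 'M[R]_(n, q) -> alg R n 'M[R]_(n, q) with
  | 0 => fun V => Ret V
  | q'.+1 => fun V : 'M[R]_(n, 1 + q') =>
      let* y := B (lsubmx V) in
      let* Y := matmul B (rsubmx V) in
      Ret (row_mx y Y : 'M[R]_(n, 1 + q'))
  end.

(* The columns of Q form an orthonormal basis of the column span of Y; they are
   then \rank Y in number. *)
Definition orthonormal_basis (R : realType) (n q : nat) (Y : 'M[R]_(n, q))
    (Q : 'M[R]_(n, \rank Y)) : Prop :=
  Q^T *m Q = 1%:M /\ (Q^T :=: Y^T)%MS.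

(* A subroutine choosing the matrix Q from Y = BS; see [orthonormalizes]. *)
Definition orthonormalizer (R : realType) (n : nat) :=
  forall (q : nat) (Y : 'M[R]_(n, q)), 'M[R]_(n, \rank Y).

Definition orthonormalizes (R : realType) (n : nat)
    (orth : orthonormalizer R n) : Prop :=
  forall (q : nat) (Y : 'M[R]_(n, q)), orthonormal_basis (orth q Y).

Definition hutchpp (R : realType) (n : nat) (orth : orthonormalizer R n)
    (l : nat) (B : oracle R n) : alg R n R :=
  Rademacher (l %/ 3) (fun S =>
  Rademacher (l %/ 3) (fun G =>
  let* Y := matmul B S in
  let Q := orth _ Y in
  let* Z := matmul B Q in
  let* W := matmul B ((1%:M - Q *m Q^T) *m G) in
  Ret (\tr (Q^T *m Z) + 3 / l%:R * \tr (G^T *m (1%:M - Q *m Q^T) *m W)))).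

(* Outputs the sequence [:: t_1; ...; t_m]. *)
Fixpoint deltashiftpp (R : realType) (n : nat) (orth : orthonormalizer R n)
    (l0 l : nat) (gamma : R) (m : nat) {struct m} : alg R n (seq R) :=
  match m with
  | 0 => Ret [::]
  | 1 => let* t := hutchpp orth l0 (orc 1) in Ret [:: t]
  | j.+1 =>
      let* ts := deltashiftpp orth l0 l gamma j in
      let* a := hutchpp orth l (orc j.+1) in
      let* b := hutchpp orth l (orc_diff j.+1 j) in
      Ret (rcons ts (gamma * a + (1 - gamma) * (last 0 ts + b)))
  end.

(* A multiple of 3 of order z, rounded up; positive when 0 < z. *)
Definition sample_size (R : realType) (z : R) : nat :=
  (3 * `|Num.ceil z|)%N.

(* The closed formula for the estimator; by [hutchppP] below, [hutchpp] outputs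
   it for two independent Rademacher matrices. *)
Definition hutchpp_value (R : realType) (n : nat) (orth : orthonormalizer R n)
    (l : nat) (B : 'M[R]_n) (S G : 'M[R]_(n, l %/ 3)) : R :=
  let Q := orth _ (B *m S) in
  \tr (Q^T *m B *m Q)
  + 3 / l%:R * \tr (G^T *m (1%:M - Q *m Q^T) *m B *m (1%:M - Q *m Q^T) *m G).

(* o evaluates v |-> B v with d products with the A_i. *)
Definition computes (R : realType) (n : nat) (A : nat -> 'M[R]_n)
    (o : oracle R n) (B : 'M[R]_n) (d : nat) : Prop :=
  forall v (X : Type) (f : 'cV[R]_n -> alg R n X),
    (forall E, Pr A (bind (o v) f) E = Pr A (f (B *m v)) E) /\
    num_matvec A (bind (o v) f) = (d + num_matvec A (f (B *m v)))%N.

Lemma computes_orc (R : realType) (n : nat) (A : nat -> 'M[R]_n) i :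
  computes A (@orc R n i) (A i) 1.
Proof. by []. Qed.

Lemma computes_orc_diff (R : realType) (n : nat) (A : nat -> 'M[R]_n) i j :
  computes A (@orc_diff R n i j) (A i - A j) 2.
Proof. by move=> v X f; rewrite /= mulmxBl. Qed.

Lemma bindA (R : realType) (n : nat) (A : nat -> 'M[R]_n) (X Y Z : Type)
    (p : alg R n X) (f : X -> alg R n Y) (g : Y -> alg R n Z) :
  (forall E, Pr A (bind (bind p f) g) E = Pr A (bind p (fun x => bind (f x) g)) E)
  /\ num_matvec A (bind (bind p f) g)
     = num_matvec A (bind p (fun x => bind (f x) g)).
Proof.
elim: p => [x|q k IH|i v k IH] //=; last by have [IH1 ->] := IH (A i *m v); split.
split=> [E|]; last by apply: eq_bigr => S _; case: (IH (sign_mx R S)).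
by congr (_ / _); apply: eq_bigr => S _; case: (IH (sign_mx R S)).
Qed.

Lemma matmulP (R : realType) (n : nat) (A : nat -> 'M[R]_n) (o : oracle R n)
    (B : 'M[R]_n) (d : nat) : computes A o B d ->
  forall q (V : 'M[R]_(n, q)) (X : Type) (f : 'M[R]_(n, q) -> alg R n X),
    (forall E, Pr A (bind (matmul o V) f) E = Pr A (f (B *m V)) E) /\
    num_matvec A (bind (matmul o V) f) = (q * d + num_matvec A (f (B *m V)))%N.
Proof.
move=> oB; elim=> [|q IHq] V X f.
  by have -> : B *m V = V by apply/matrixP => i [].
pose h (y : 'cV[R]_n) (Y : 'M[R]_(n, q)) :=
  Ret (row_mx y Y : 'M[R]_(n, 1 + q)) : alg R n _.
pose g (y : 'cV[R]_n) := bind (matmul o (@rsubmx R n 1 q V)) (h y).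
rewrite [matmul o V]/(bind (o (@lsubmx R n 1 q V)) g).
have [P1 ->] := bindA A (o (@lsubmx R n 1 q V)) g f.
have [P2 ->] := oB (@lsubmx R n 1 q V) _ (fun y => bind (g y) f).
set y := B *m @lsubmx R n 1 q V in P2 *.
have [P3 ->] := bindA A (matmul o (@rsubmx R n 1 q V)) (h y) f.
have [P4 ->] := IHq (@rsubmx R n 1 q V) _ (fun Y => bind (h y Y) f).
have BV : row_mx (B *m @lsubmx R n 1 q V) (B *m @rsubmx R n 1 q V) = B *m V.
  by rewrite -mul_mx_row hsubmxK.
split=> [E|]; last by rewrite /= BV mulSn addnA.
by rewrite P1 P2 P3 P4 /= BV.
Qed.

Lemma hutchppP (R : realType) (n : nat) (A : nat -> 'M[R]_n) (o : oracle R n)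
    (B : 'M[R]_n) (d : nat) (orth : orthonormalizer R n) (l : nat) :
  computes A o B d ->
  (forall E, Pr A (hutchpp orth l o) E =
     (\sum_(S : 'M[bool]_(n, l %/ 3))
        (\sum_(G : 'M[bool]_(n, l %/ 3))
           (E (hutchpp_value orth B (sign_mx R S) (sign_mx R G)))%:R)
        / #|{: 'M[bool]_(n, l %/ 3)}|%:R) / #|{: 'M[bool]_(n, l %/ 3)}|%:R) /\
  (num_matvec A (hutchpp orth l o) <= l * d)%N.
Proof.
move=> oB; rewrite /hutchpp /=; split=> [E|].
  congr (_ / _); apply: eq_bigr => S _; congr (_ / _); apply: eq_bigr => G _.
  by rewrite !(matmulP oB _ _).1 /= !mulmxA.
apply/bigmax_leqP => S _; apply/bigmax_leqP => G _.
rewrite !(matmulP oB _ _).2 /= addn0 -!mulnDl leq_mul2r; apply/orP; right.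
rewrite addnA (leq_trans _ (leq_divM l 3)) // mulnC !mulSn mul0n addn0.
by rewrite addnA leq_add2r leq_add2l rank_leq_col.
Qed.

Lemma orthonormalizer_exists (R : realType) (n : nat) :
  exists orth : orthonormalizer R n, orthonormalizes orth.
Proof.
have gram_schmidt p (M : 'M[R]_(p, n)) : exists r (P : 'M[R]_(r, n)),
    P *m P^T = 1%:M /\ (P :=: M)%MS.
  elim: p M => [|p IHp] M.
    by exists 0%N, 0; split; [apply/matrixP => - []|rewrite (flatmx0 M)].
  rewrite -[M](@vsubmxK _ 1 p); move: (@usubmx _ 1 p _ _) (@dsubmx _ 1 p _ _).
  move=> u {}M; have [r [P [PP PM]]] := IHp M.
  suff [r' [P' [PP' PM']]] : exists r (P : 'M[R]_(r, n)),
      P *m P^T = 1%:M /\ (P :=: u + M)%MS.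
    by exists r', P'; split=> //; apply: eqmx_trans PM' (addsmxE _ _).
  pose w := u - u *m P^T *m P.
  have wP : w *m P^T = 0 by rewrite mulmxBl -[X in _ - X]mulmxA PP mulmx1 subrr.
  have uwP : (u + M :=: w + P)%MS.
    apply: eqmx_trans (adds_eqmx (eqmx_refl u) (eqmx_sym PM)) _.
    apply/eqmxP/andP; split; rewrite addsmx_sub addsmxSr andbT.
      have -> : u = w + u *m P^T *m P by rewrite subrK.
      by rewrite addmx_sub_adds ?submxMl.
    by rewrite addmx_sub ?addsmxSl // -mulNmx (submx_trans (submxMl _ _)) ?addsmxSr.
  have [w0|wN0] := eqVneq w 0.
    exists r, P; split=> //; apply/eqmx_sym/(eqmx_trans uwP).
    by rewrite w0; exact: adds0mx.
  pose s := \sum_j (w 0 j) ^+ 2.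
  have ww : w *m w^T = s%:M.
    apply/matrixP => i j; rewrite !ord1 !mxE eqxx mulr1n.
    by apply: eq_bigr => k _; rewrite [w^T _ _]mxE expr2.
  have s_gt0 : 0 < s.
    rewrite lt_def sumr_ge0 ?andbT => [|j _]; last exact: sqr_ge0.
    apply: contraNneq wN0 => /eqP; rewrite psumr_eq0 => [/allP w0|j _];
      last exact: sqr_ge0.
    apply/eqP/rowP => j; have := w0 j (mem_index_enum _).
    by rewrite [RHS]mxE /= sqrf_eq0 => /eqP.
  pose a := (Num.sqrt s)^-1.
  have a2 : a * a * s = 1.
    by rewrite -expr2 exprVn sqr_sqrtr ?ltW // mulVf // gt_eqF.
  exists (1 + r)%N, (col_mx (a *: w) P); split; last first.
    apply: eqmx_trans (eqmx_sym (addsmxE _ _)) _.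
    apply: eqmx_trans _ (eqmx_sym uwP).
    by apply: adds_eqmx (eqmx_refl P); apply: eqmx_scale; rewrite invr_eq0 gt_eqF ?sqrtr_gt0.
  rewrite tr_col_mx mul_col_row PP -!scalemxAl wP scaler0.
  rewrite !linearZ /= ww scalerA scale_scalar_mx a2.
  have -> : P *m w^T = 0 by rewrite -[P]trmxK -trmx_mul wP trmx0.
  by rewrite scaler0 -scalar_mx_block.
have basis q (Y : 'M[R]_(n, q)) :
    exists Q : 'M[R]_(n, \rank Y), orthonormal_basis Q.
  have [r [P [PP PY]]] := gram_schmidt q Y^T.
  have rE : r = \rank Y.
    rewrite -mxrank_tr -PY; apply/eqP; rewrite eqn_leq rank_leq_row andbT.
    by rewrite -[X in (X <= _)%N](@mxrank1 R) -PP mxrankM_maxl.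
  move: P PP PY; rewrite rE => P PP PY.
  by exists P^T; rewrite /orthonormal_basis trmxK.
by exists (fun q Y => projT1 (cid (basis q Y))) => q Y; case: cid.
Qed.

(* Main.v *)
Require Import Defs.
From mathcomp Require Import all_boot all_order all_algebra.
From mathcomp Require Import ring lra polyrcf complex.
From mathcomp Require Import reals.

(** Conditionally on the sketch [S], the error of Hutch++ is that of Hutchinson's
    estimator on the deflated matrix, so its mean square is at most [2 / q] times the
    expected squared Frobenius error of the sketch ([q = l / 3] columns).  That error
    is bounded by adding the columns of [S] one at a time: if [C] is the current
    residual and [M = C^T C], a new sign vector [s] removes [s^T M^2 s / s^T M s] from
    [f = \tr M], and by the fourth moments of [s] this is at least
    [\tr M^2 / (3 \tr M)] on average.  Interpolation between Schatten norms gives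
    [\tr M^2 >= f^3 / N^2], where [N] is the nuclear norm, hence
    [E f' <= f - f^2 / (3 N^2)]: each column adds at least [1 / (3 N^2)] to [1 / f], a
    rate that survives the averaging by concavity of [f |-> 1 / (1 / f + k)].  So
    [E f <= 3 N^2 / q] after [q] columns, and the mean square error of Hutch++ is at
    most [6 N^2 / q^2].  In DeltaShift++ the damping makes these errors sum
    geometrically; Chebyshev's inequality concludes. *)

Set Implicit Arguments.
Unset Strict Implicit.
Unset Printing Implicit Defensive.

Import Order.TTheory GRing.Theory Num.Theory.
Local Open Scope ring_scope.

(** * The Frobenius norm and orthogonal projectors *)

Definition fro2 (R : comNzRingType) (m n : nat) (C : 'M[R]_(m, n)) : R :=
  \sum_i \sum_j C i j ^+ 2.

Definition quad (R : comNzRingType) (n q : nat) (X : 'M[R]_n)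
    (S : 'M[R]_(n, q)) : R :=
  \tr (S^T *m X *m S).

Definition gram (R : comNzRingType) (m n : nat) (C : 'M[R]_(m, n)) : 'M[R]_n :=
  C^T *m C.

Section FrobeniusRing.
Variable R : comNzRingType.

Lemma tr_gram (m n : nat) (C : 'M[R]_(m, n)) : (gram C)^T = gram C.
Proof. by rewrite trmx_mul trmxK. Qed.

Lemma fro2E (m n : nat) (C : 'M[R]_(m, n)) : fro2 C = \tr (gram C).
Proof.
rewrite /fro2 exchange_big; apply: eq_bigr => j _; rewrite mxE.
by apply: eq_bigr => i _; rewrite mxE expr2.
Qed.

Lemma fro2_tr (m n : nat) (C : 'M[R]_(m, n)) : fro2 C^T = fro2 C.
Proof.
by rewrite /fro2 exchange_big; do 2 (apply: eq_bigr => ? _); rewrite mxE.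
Qed.

Lemma fro2Z (m n : nat) (a : R) (C : 'M[R]_(m, n)) :
  fro2 (a *: C) = a ^+ 2 * fro2 C.
Proof.
rewrite /fro2 mulr_sumr; apply: eq_bigr => i _; rewrite mulr_sumr.
by apply: eq_bigr => j _; rewrite mxE exprMn.
Qed.

Lemma fro2D (m n : nat) (C D : 'M[R]_(m, n)) :
  fro2 (C + D) = fro2 C + \tr (C^T *m D) *+ 2 + fro2 D.
Proof.
rewrite !fro2E /gram [(C + D)^T]linearD /= mulmxDr !mulmxDl !raddfD /=.
have -> : \tr (D^T *m C) = \tr (C^T *m D).
  by rewrite -mxtrace_tr trmx_mul trmxK.
by ring.
Qed.

Lemma mul_col_fro2 (n : nat) (y : 'cV[R]_n) : y^T *m y = (fro2 y)%:M.
Proof. by rewrite [LHS]mx11_scalar fro2E /mxtrace big_ord1. Qed.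

Lemma mul_row_fro2 (n : nat) (u : 'rV[R]_n) : u *m u^T = (fro2 u)%:M.
Proof. by rewrite -fro2_tr -mul_col_fro2 trmxK. Qed.

Lemma fro2_mul_orthogonal (m n : nat) (C : 'M[R]_(m, n)) (W : 'M[R]_n) :
  W *m W^T = 1%:M -> fro2 (C *m W^T) = fro2 C.
Proof.
move=> WW; rewrite !fro2E /gram trmx_mul trmxK mxtrace_mulC mulmxA -(mulmxA C).
by rewrite (mulmx1C WW) mulmx1 mxtrace_mulC.
Qed.

Lemma fro2_conj_orthogonal (n : nat) (C W : 'M[R]_n) :
  W *m W^T = 1%:M -> fro2 (W *m C *m W^T) = fro2 C.
Proof.
move=> WW; rewrite fro2_mul_orthogonal // -fro2_tr trmx_mul.
by rewrite fro2_mul_orthogonal // fro2_tr.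
Qed.

Lemma fro2_mul_quad (m n q : nat) (C : 'M[R]_(m, n)) (S : 'M[R]_(n, q)) :
  fro2 (C *m S) = quad (gram C) S.
Proof. by rewrite fro2E /gram trmx_mul /quad !mulmxA. Qed.

Lemma quadE (n : nat) (X : 'M[R]_n) (s : 'cV[R]_n) :
  quad X s = \sum_a \sum_b X a b * (s a 0 * s b 0).
Proof.
rewrite /quad /mxtrace big_ord1 mxE exchange_big; apply: eq_bigr => b _.
rewrite mxE mulr_suml; apply: eq_bigr => a _; rewrite mxE; ring.
Qed.

Lemma conj_diagE (n : nat) (W X : 'M[R]_n) i :
  (W *m X *m W^T) i i = quad X (row i W)^T.
Proof.
rewrite /quad trmxK -row_mul /mxtrace big_ord1 !mxE.
by apply: eq_bigr => k _; rewrite !mxE.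
Qed.

Lemma quad_row_mx (n p q : nat) (X : 'M[R]_n) (S : 'M[R]_(n, p))
    (G : 'M[R]_(n, q)) :
  quad X (row_mx S G) = quad X S + quad X G.
Proof. by rewrite /quad tr_row_mx mul_col_mx mul_col_row mxtrace_block. Qed.

End FrobeniusRing.

Section FrobeniusOrder.
Variable R : realDomainType.

Lemma fro2_ge0 (m n : nat) (C : 'M[R]_(m, n)) : 0 <= fro2 C.
Proof. by do 2 (apply: sumr_ge0 => ? _); exact: sqr_ge0. Qed.

Lemma fro2_eq0 (m n : nat) (C : 'M[R]_(m, n)) : (fro2 C == 0) = (C == 0).
Proof.
have sum_ge0 i : 0 <= \sum_j C i j ^+ 2 by apply: sumr_ge0 => j _; exact: sqr_ge0.
apply/idP/eqP => [|->]; last first.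
  by rewrite /fro2 big1 // => i _; rewrite big1 // => j _; rewrite mxE expr0n.
rewrite psumr_eq0 // => /allP C0; apply/matrixP => i j; rewrite mxE.
have := C0 i (mem_index_enum _); rewrite /= psumr_eq0 => [/allP|k _].
  by move/(_ j (mem_index_enum _)); rewrite /= sqrf_eq0 => /eqP.
exact: sqr_ge0.
Qed.

Lemma fro2_gt0 (m n : nat) (C : 'M[R]_(m, n)) : (0 < fro2 C) = (C != 0).
Proof. by rewrite lt_def fro2_ge0 andbT fro2_eq0. Qed.

Lemma gram_diag_ge0 (m n : nat) (C : 'M[R]_(m, n)) i : 0 <= gram C i i.
Proof. by rewrite mxE; apply: sumr_ge0 => k _; rewrite mxE -expr2 sqr_ge0. Qed.

Lemma sum_sqr_diag_le (n : nat) (C : 'M[R]_n) :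
  \sum_i C i i ^+ 2 <= fro2 C.
Proof.
apply: ler_sum => i _; rewrite (bigD1 i) //= lerDl.
by apply: sumr_ge0 => j _; exact: sqr_ge0.
Qed.

Lemma mxtrace_sqr_le (n : nat) (C : 'M[R]_n) : \tr (C *m C) <= fro2 C.
Proof.
have := fro2_ge0 (C^T - C); rewrite fro2D -scaleN1r fro2Z trmxK fro2_tr.
by rewrite -scalemxAr linearZ /= mulr2n; lra.
Qed.

Lemma weighted_cauchy_schwarz (I : finType) (w a b : I -> R) :
  (forall i, 0 <= w i) ->
  (\sum_i w i * (a i * b i)) ^+ 2
  <= (\sum_i w i * a i ^+ 2) * (\sum_i w i * b i ^+ 2).
Proof.
move=> w_ge0.
have : 0 <= \sum_i \sum_j w i * w j * (a i * b j - a j * b i) ^+ 2.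
  by do 2 (apply: sumr_ge0 => ? _); rewrite mulr_ge0 ?sqr_ge0 // mulr_ge0.
rewrite (eq_bigr (fun i => w i * a i ^+ 2 * (\sum_j w j * b j ^+ 2)
    - 2 * (w i * (a i * b i)) * (\sum_j w j * (a j * b j))
    + w i * b i ^+ 2 * (\sum_j w j * a j ^+ 2))) => [|i _]; last first.
  rewrite !mulr_sumr -sumrB -big_split /=; apply: eq_bigr => j _.
  by ring.
by rewrite big_split sumrB /= -!mulr_suml -mulr_sumr expr2; lra.
Qed.

Lemma fro2_mul (m n p : nat) (C : 'M[R]_(m, n)) (D : 'M[R]_(n, p)) :
  fro2 (C *m D) <= fro2 C * fro2 D.
Proof.
rewrite -(fro2_tr D) /fro2 mulr_suml; apply: ler_sum => i _.
rewrite mulr_sumr; apply: ler_sum => j _; rewrite mxE.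
have := weighted_cauchy_schwarz (C i) (D^~ j) (fun=> ler01).
under eq_bigr do rewrite mul1r.
under [X in _ <= X * _]eq_bigr do rewrite mul1r.
under [X in _ <= _ * X]eq_bigr do rewrite mul1r.
by under [X in _ -> _ <= _ * X]eq_bigr do rewrite mxE.
Qed.

(* Hoelder's inequality between the l^1, l^2 and l^4 norms. *)
Lemma sum_sqr_interpolation (I : finType) (e : I -> R) :
  (forall i, 0 <= e i) ->
  (\sum_i e i ^+ 2) ^+ 3 <= (\sum_i e i) ^+ 2 * \sum_i e i ^+ 4.
Proof.
move=> e_ge0; have pow_ge0 k : 0 <= \sum_i e i ^+ k.
  by apply: sumr_ge0 => i _; rewrite exprn_ge0.
have l2_l1_l3 : (\sum_i e i ^+ 2) ^+ 2 <= (\sum_i e i) * \sum_i e i ^+ 3.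
  have := weighted_cauchy_schwarz (fun=> 1) e e_ge0.
  under eq_bigr do rewrite mul1r.
  under [X in _ <= X * _]eq_bigr do rewrite expr1n mulr1.
  by under [X in _ <= _ * X]eq_bigr do rewrite -exprS.
have l3_l2_l4 : (\sum_i e i ^+ 3) ^+ 2 <= (\sum_i e i ^+ 2) * \sum_i e i ^+ 4.
  have := weighted_cauchy_schwarz (fun=> 1) e (fun i => exprn_ge0 2 (e_ge0 i)).
  under eq_bigr do rewrite mul1r -exprSr.
  under [X in _ <= X * _]eq_bigr do rewrite expr1n mulr1.
  by under [X in _ <= _ * X]eq_bigr do rewrite -exprD.
have [->|l2_neq0] := eqVneq (\sum_i e i ^+ 2) 0.
  by rewrite expr0n mulr_ge0 ?sqr_ge0.
have l2_gt0 : 0 < \sum_i e i ^+ 2 by rewrite lt_def l2_neq0 pow_ge0.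
rewrite -(ler_pM2l l2_gt0) -exprS (exprM _ 2 2) mulrCA.
apply: (@le_trans _ _ (((\sum_i e i) * \sum_i e i ^+ 3) ^+ 2)).
  by rewrite lerXn2r ?nnegrE ?sqr_ge0 ?mulr_ge0 ?pow_ge0 ?sumr_ge0.
by rewrite exprMn ler_wpM2l ?sqr_ge0.
Qed.

End FrobeniusOrder.

Section OrthogonalProjectors.
Variable R : realFieldType.

Definition orthoproj (n : nat) (P : 'M[R]_n) : Prop := P^T = P /\ P *m P = P.

(* This is [0] when [y = 0], the inverse being then [0]. *)
Definition line_proj (n : nat) (y : 'cV[R]_n) : 'M[R]_n :=
  (fro2 y)^-1 *: (y *m y^T).

Lemma orthoproj_compl (n : nat) (P : 'M[R]_n) :
  orthoproj P -> orthoproj (1%:M - P).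
Proof.
move=> [PT PP]; split; first by rewrite linearB /= trmx1 PT.
by rewrite mulmxBl mul1mx mulmxBr mulmx1 PP subrr subr0.
Qed.

Lemma orthoproj_frame (n p : nat) (Q : 'M[R]_(n, p)) :
  Q^T *m Q = 1%:M -> orthoproj (Q *m Q^T).
Proof.
move=> QQ; split; first by rewrite trmx_mul trmxK.
by rewrite mulmxA -(mulmxA Q) QQ mulmx1.
Qed.

Lemma fro2_orthoproj_compl (m n : nat) (P : 'M[R]_m) (C : 'M[R]_(m, n)) :
  orthoproj P -> fro2 ((1%:M - P) *m C) = fro2 C - fro2 (P *m C).
Proof.
move=> projP; have [compT compK] := orthoproj_compl projP; case: projP => PT PP.
rewrite !fro2_mul_quad /gram compT compK PT PP /quad mulmxBr mulmxBl mulmx1.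
by rewrite raddfB /= fro2E.
Qed.

Lemma fro2_orthoproj_compl_le (m n : nat) (P : 'M[R]_m) (C : 'M[R]_(m, n)) :
  orthoproj P -> fro2 ((1%:M - P) *m C) <= fro2 C.
Proof. by move=> projP; rewrite fro2_orthoproj_compl // gerBl fro2_ge0. Qed.

Lemma orthoproj_line (n : nat) (y : 'cV[R]_n) : orthoproj (line_proj y).
Proof.
split; first by rewrite linearZ /= trmx_mul trmxK.
have [->|y_neq0] := eqVneq y 0; first by rewrite /line_proj mul0mx scaler0 mul0mx.
rewrite -scalemxAl -scalemxAr mulmxA -(mulmxA y) mul_col_fro2 mul_mx_scalar.
by rewrite -scalemxAl !scalerA mulVf ?mulr1 // fro2_eq0.
Qed.

Lemma fro2_line_proj_mul (m n : nat) (y : 'cV[R]_m) (C : 'M[R]_(m, n)) :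
  fro2 (line_proj y *m C) = fro2 (y^T *m C) / fro2 y.
Proof.
have [projT projK] := orthoproj_line y.
rewrite fro2_mul_quad /gram projT projK /quad -scalemxAr -scalemxAl linearZ /= mulrC.
by congr (_ / _); rewrite fro2E /gram trmx_mul trmxK !mulmxA.
Qed.

End OrthogonalProjectors.

(** * The spectral theorem and singular values *)

Lemma char_poly_conj (R : comNzRingType) (n : nat) (A W V : 'M[R]_n) :
  W *m V = 1%:M -> char_poly (W *m A *m V) = char_poly A.
Proof.
move=> WV; have WVP : map_mx polyC W *m map_mx polyC V = 1%:M.
  by rewrite -map_mxM WV map_mx1.
have conjE : char_poly_mx (W *m A *m V)
    = map_mx polyC W *m char_poly_mx A *m map_mx polyC V.
  rewrite /char_poly_mx mulmxBr mulmxBl mul_mx_scalar -scalemxAl WVP scalemx1.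
  by rewrite !map_mxM.
by rewrite /char_poly conjE !det_mulmx mulrAC -det_mulmx WVP det1 mul1r.
Qed.

Lemma hermsymmx_eigenvalue_real (C : numClosedFieldType) (n : nat)
    (A : 'M[C]_n) (z : C) :
  A \is hermsymmx -> eigenvalue A z -> z \is Num.real.
Proof.
move=> Aherm; rewrite eigenvalue_root_char.
have /orthomx_spectralP AE := hermitian_normalmx Aherm.
rewrite {1}AE char_poly_conj; last by rewrite mulVmx // spectral_unit.
rewrite char_poly_trig ?diag_mx_is_trig // -(big_map _ xpredT (fun x => 'X - x%:P)).
rewrite root_prod_XsubC => /mapP[i _ ->]; rewrite mxE eqxx.
exact: (mxOverP (hermitian_spectral_diag_real Aherm)).
Qed.

Lemma symmetric_stable_eigenvector (R : rcfType) (m n : nat) (A : 'M[R]_n)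
    (V : 'M[R]_(m, n)) :
  A^T = A -> stablemx V A -> V != 0 ->
  exists a (v : 'rV_n), [/\ v != 0, (v <= V)%MS & v *m A = a *: v].
Proof.
move=> Asym; rewrite -stablemx_row_base -mxrank_eq0 -lt0n => stabB V_neq0.
pose toC := real_complex R; set B := row_base V in stabB; pose F := conjmx B A.
have B_free : row_free B by exact: row_base_free.
have Aherm : map_mx toC A \is hermsymmx.
  apply: realsym_hermsym.
    by apply/is_hermitianmxP; rewrite expr0 scale1r map_mx_id // map_trmx Asym.
  by apply/mxOverP => i j; rewrite mxE complex_real.
have [z zF] := eigenvalue_closed (map_mx toC F) V_neq0.
have /complex_realP[a zE] : z \is Num.real.
  apply: (hermsymmx_eigenvalue_real Aherm).
  have FE : map_mx toC F = conjmx (map_mx toC B) (map_mx toC A).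
    by rewrite /F /conjmx 2!map_mxM map_pinvmx.
  rewrite FE in zF; apply: eigenvalue_conjmx zF; last by rewrite row_free_map.
  by rewrite -map_mxM map_submx.
have /eigenvalueP[w wF w_neq0] : eigenvalue F a.
  rewrite eigenvalue_root_char -(fmorph_root toC) map_char_poly.
  by rewrite zE eigenvalue_root_char in zF.
exists a, (w *m B); split.
- by rewrite mulmx_free_eq0.
- by rewrite (submx_trans (submxMl _ _)) // eq_row_base.
- by rewrite -mulmxA -[B *m A](mulmxKpV stabB) -/F mulmxA wF scalemxAl.
Qed.

Lemma symmetric_orthonormal_eigenvectors (R : rcfType) (n k : nat) (A : 'M[R]_n) :
  A^T = A -> (k <= n)%N ->
  exists (U : 'M[R]_(k, n)) (d : 'rV_k), U *m U^T = 1%:M /\ U *m A = diag_mx d *m U.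
Proof.
move=> Asym; elim: k => [|k IHk] kn.
  by exists 0, 0; split; apply/matrixP => - [].
have [U [d [UU UA]]] := IHk (ltnW kn).
have [||a [v [v_neq0 /sub_kermxP vU vA]]] :=
  @symmetric_stable_eigenvector _ _ _ A (kermx U^T) Asym.
- apply/sub_kermxP; rewrite -mulmxA.
  have -> : A *m U^T = (U *m A)^T by rewrite trmx_mul Asym.
  by rewrite UA trmx_mul mulmxA mulmx_ker mul0mx.
- rewrite -mxrank_eq0 mxrank_ker mxrank_tr -lt0n subn_gt0.
  exact: leq_ltn_trans (rank_leq_row U) kn.
pose c := (Num.sqrt (fro2 v))^-1.
have cv : c ^+ 2 * fro2 v = 1.
  by rewrite exprVn sqr_sqrtr ?fro2_ge0 // mulVf // fro2_eq0.
have Uv : U *m v^T = 0 by rewrite -[LHS]trmxK trmx_mul trmxK vU trmx0.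
rewrite -[k.+1]/(1 + k)%N; exists (col_mx (c *: v) U), (row_mx a%:M d); split.
  rewrite tr_col_mx mul_col_row UU linearZ /= -!scalemxAl -!scalemxAr vU Uv !scaler0.
  by rewrite scalerA -expr2 mul_row_fro2 scale_scalar_mx cv -scalar_mx_block.
rewrite mul_col_mx UA diag_mx_row mul_block_col !mul0mx addr0 add0r.
rewrite -scalemxAl vA; congr col_mx.
have -> : diag_mx a%:M = a%:M :> 'M_1.
  by apply/matrixP => i j; rewrite !ord1 !mxE.
by rewrite mul_scalar_mx !scalerA mulrC.
Qed.

Lemma spectral_theorem_real (R : rcfType) (n : nat) (A : 'M[R]_n) : A^T = A ->
  exists (W : 'M[R]_n) (d : 'rV[R]_n),
    W *m W^T = 1%:M /\ W *m A *m W^T = diag_mx d.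
Proof.
move=> Asym.
have [W [d [WW WA]]] := symmetric_orthonormal_eigenvectors Asym (leqnn n).
by exists W, d; rewrite WA -mulmxA WW mulmx1.
Qed.

Lemma singular_values_perm (R : realType) (n : nat) (B W : 'M[R]_n) (d : 'rV[R]_n) :
  W *m W^T = 1%:M -> W *m gram B *m W^T = diag_mx d ->
  perm_eq (singular_values B) [seq Num.sqrt (d 0 i) | i <- enum 'I_n].
Proof.
move=> WW WB; pose s := [seq d 0 i | i <- enum 'I_n].
have pE : char_poly (gram B) = \prod_(x <- s) ('X - x%:P).
  rewrite -(char_poly_conj _ WW) WB char_poly_trig ?diag_mx_is_trig //.
  by rewrite big_map big_enum; apply: eq_bigr => i _; rewrite mxE eqxx.
have roots_s : perm_eq (rootsR (\prod_(x <- s) ('X - x%:P))) (undup s).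
  rewrite uniq_perm ?undup_uniq ?uniq_roots // => x.
  have p_neq0 : \prod_(x <- s) ('X - x%:P) != 0 by rewrite monic_neq0 ?monic_prod_XsubC.
  rewrite mem_undup -[RHS]root_prod_XsubC; apply/esym.
  exact: (roots_onP (roots_on_rootsR p_neq0)).
rewrite /singular_values -/(gram B) pE (map_comp Num.sqrt (d 0)) -/s.
under eq_map do rewrite mu_prod_XsubC -map_nseq.
rewrite (map_comp (map Num.sqrt)) -map_flatten perm_map //.
by apply: perm_trans (perm_count_undup s); apply/perm_flatten/perm_map.
Qed.

Lemma nuclear_normE (R : realType) (n : nat) (B W : 'M[R]_n) (d : 'rV[R]_n) :
  W *m W^T = 1%:M -> W *m gram B *m W^T = diag_mx d ->
  nuclear_norm B = \sum_i Num.sqrt (d 0 i).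
Proof.
move=> WW WB; rewrite /nuclear_norm (perm_big _ (singular_values_perm WW WB)).
by rewrite big_map big_enum.
Qed.

Lemma nuclear_norm_ge0 (R : realType) (n : nat) (B : 'M[R]_n) :
  0 <= nuclear_norm B.
Proof.
rewrite /nuclear_norm /singular_values big_flatten big_map.
by apply: sumr_ge0 => x _; rewrite big_nseq iter_addr_0 mulrn_wge0 ?sqrtr_ge0.
Qed.

(** * Rademacher matrices *)

Definition rademacher_mean (R : realType) (n q : nat) (F : 'M[R]_(n, q) -> R) : R :=
  (\sum_(S : 'M[bool]_(n, q)) F (sign_mx R S)) / #|{: 'M[bool]_(n, q)}|%:R.

Section RademacherMean.
Variables (R : realType) (n q : nat).
Implicit Types F H : 'M[R]_(n, q) -> R.

Lemma rademacher_mean_le F H :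
  (forall S, F S <= H S) -> rademacher_mean F <= rademacher_mean H.
Proof. by move=> FH; rewrite ler_wpM2r ?invr_ge0 ?ler0n // ler_sum. Qed.

Lemma eq_rademacher_mean F H : F =1 H -> rademacher_mean F = rademacher_mean H.
Proof. by move=> FH; congr (_ / _); apply: eq_bigr => S _; rewrite FH. Qed.

Lemma rademacher_mean_cst c : rademacher_mean (fun _ : 'M[R]_(n, q) => c) = c.
Proof.
rewrite /rademacher_mean sumr_const -[c *+ _]mulr_natr mulfK //.
by rewrite pnatr_eq0 -lt0n; apply/card_gt0P; exists (const_mx true).
Qed.

Lemma rademacher_meanD F H :
  rademacher_mean (fun S => F S + H S) = rademacher_mean F + rademacher_mean H.
Proof. by rewrite /rademacher_mean big_split mulrDl. Qed.

Lemma rademacher_meanZ c F :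
  rademacher_mean (fun S => c * F S) = c * rademacher_mean F.
Proof. by rewrite /rademacher_mean -mulr_sumr mulrA. Qed.

Lemma rademacher_mean_sum (I : finType) (F : I -> 'M[R]_(n, q) -> R) :
  rademacher_mean (fun S => \sum_i F i S) = \sum_i rademacher_mean (F i).
Proof. by rewrite /rademacher_mean exchange_big mulr_suml. Qed.

End RademacherMean.

Lemma rademacher_mean0 (R : realType) (n : nat) (F : 'M[R]_(n, 0) -> R) :
  rademacher_mean F = F 0.
Proof.
rewrite -[RHS](@rademacher_mean_cst R n 0); apply: eq_rademacher_mean => S.
by rewrite thinmx0.
Qed.

Lemma rademacher_mean_row_mx (R : realType) (n p q : nat)
    (F : 'M[R]_(n, p + q) -> R) :
  rademacher_mean F =
  rademacher_mean (fun S : 'M[R]_(n, p) =>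
    rademacher_mean (fun G : 'M[R]_(n, q) => F (row_mx S G))).
Proof.
rewrite /rademacher_mean -mulr_suml -mulrA -invfM -natrM.
congr (_ / _%:R); last by rewrite !card_mx -!expnD -mulnDr addnC.
rewrite pair_bigA (reindex (fun S => row_mx S.1 S.2)) /=.
  by apply: eq_bigr => S _; rewrite /sign_mx map_row_mx.
exists (fun S => (lsubmx S, rsubmx S)) => [[S G]|S] _ /=.
  by rewrite row_mxKl row_mxKr.
by rewrite hsubmxK.
Qed.

Section RademacherMoments.
Variables (R : realType) (n : nat).
Implicit Types (s : 'cV[R]_n) (X Y : 'M[R]_n) (F : 'cV[R]_n -> R).

Lemma rademacher_mean_sqr_entry F a :
  rademacher_mean (fun s => s a 0 * s a 0 * F s) = rademacher_mean F.
Proof.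
by congr (_ / _); apply: eq_bigr => s _; rewrite mxE -expr2 sqrr_sign mul1r.
Qed.

Lemma rademacher_mean_odd F a :
  (forall s, F (\col_i ((-1) ^+ (i == a) * s i 0)) = - F s) ->
  rademacher_mean F = 0.
Proof.
move=> Fodd; suff : rademacher_mean F = - rademacher_mean F by lra.
rewrite {1}/rademacher_mean /rademacher_mean -mulNr -sumrN; congr (_ / _).
pose flip (s : 'cV[bool]_n) := \col_i ((i == a) (+) s i 0).
have flipK : involutive flip.
  by move=> s; apply/colP => i; rewrite !mxE addKb.
rewrite (reindex_inj (inv_inj flipK)); apply: eq_bigr => s _; rewrite -Fodd.
by congr F; apply/colP => i; rewrite !mxE signr_addb.
Qed.

Lemma rademacher_moment2 (a b : 'I_n) :
  rademacher_mean (fun s => s a 0 * s b 0) = (a == b)%:R.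
Proof.
have [<-|ab] := eqVneq a b.
  rewrite -[RHS](@rademacher_mean_cst R n 1) -[RHS](rademacher_mean_sqr_entry _ a).
  by apply: eq_rademacher_mean => s; rewrite mulr1.
apply: (@rademacher_mean_odd _ a) => s.
by rewrite !mxE eqxx eq_sym (negbTE ab); ring.
Qed.

Lemma rademacher_moment4 (a b c d : 'I_n) : c != d ->
  rademacher_mean (fun s => s a 0 * s b 0 * (s c 0 * s d 0)) =
  (a == c)%:R * (b == d)%:R + (a == d)%:R * (b == c)%:R.
Proof.
move=> cd; have [<-|ab] := eqVneq a b.
  rewrite rademacher_mean_sqr_entry rademacher_moment2 (negbTE cd).
  by have [->|_] := eqVneq a c; rewrite ?(negbTE cd) ?mulr0 ?mul0r addr0.
have [ac|ac] := eqVneq a c; have [ad|ad] := eqVneq a d.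
- by rewrite -ac -ad eqxx in cd.
- rewrite mul0r mul1r addr0 -rademacher_moment2 -[RHS](rademacher_mean_sqr_entry _ a).
  by apply: eq_rademacher_mean => s; rewrite -ac; ring.
- rewrite mul0r mul1r add0r -rademacher_moment2 -[RHS](rademacher_mean_sqr_entry _ a).
  by apply: eq_rademacher_mean => s; rewrite -ad; ring.
rewrite !mul0r addr0; apply: (@rademacher_mean_odd _ a) => s; rewrite !mxE eqxx.
by rewrite ![_ == a]eq_sym (negbTE ab) (negbTE ac) (negbTE ad); ring.
Qed.

Lemma rademacher_mean_quad X : rademacher_mean (fun s => quad X s) = \tr X.
Proof.
under eq_rademacher_mean do rewrite quadE.
rewrite rademacher_mean_sum; apply: eq_bigr => a _.
rewrite rademacher_mean_sum (bigD1 a) //= big1 ?addr0 => [|b ba].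
  by rewrite rademacher_meanZ rademacher_moment2 eqxx mulr1.
by rewrite rademacher_meanZ rademacher_moment2 eq_sym (negbTE ba) mulr0.
Qed.

Lemma rademacher_mean_quad_entries X (c d : 'I_n) :
  rademacher_mean (fun s => s c 0 * s d 0 * quad X s) =
  if c == d then \tr X else X c d + X d c.
Proof.
have [<-|cd] := eqVneq c d.
  by rewrite rademacher_mean_sqr_entry rademacher_mean_quad.
have entry (a b : 'I_n) : \sum_i \sum_j X i j * ((i == a)%:R * (j == b)%:R) = X a b.
  rewrite (bigD1 a) //= (bigD1 b) //= !eqxx !mulr1 !big1 ?addr0 // => i.
    by move/negbTE->; rewrite big1 // => j _; rewrite mul0r mulr0.
  by move/negbTE->; rewrite !mulr0.
rewrite -(entry c d) -(entry d c) -big_split /=.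
under eq_rademacher_mean do rewrite quadE mulr_sumr.
rewrite rademacher_mean_sum; apply: eq_bigr => a _; rewrite -big_split /=.
under eq_rademacher_mean do rewrite mulr_sumr.
rewrite rademacher_mean_sum; apply: eq_bigr => b _.
rewrite -mulrDr -(rademacher_moment4 a b cd) -rademacher_meanZ.
by apply: eq_rademacher_mean => s; ring.
Qed.

Lemma rademacher_mean_quad_mul X Y :
  rademacher_mean (fun s => quad X s * quad Y s) =
  \tr X * \tr Y + \tr (X^T *m Y) + \tr (X *m Y) - (\sum_a X a a * Y a a) *+ 2.
Proof.
have entryE a b : rademacher_mean (fun s => X a b * (s a 0 * s b 0 * quad Y s)) =
    (X a b * Y a b + X a b * Y b a)
    + (if b == a then X a a * \tr Y - (X a a * Y a a) *+ 2 else 0).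
  rewrite rademacher_meanZ rademacher_mean_quad_entries eq_sym.
  by have [->|_] := eqVneq b a; ring.
transitivity (\sum_a \sum_b rademacher_mean
    (fun s => X a b * (s a 0 * s b 0 * quad Y s))).
  under [LHS]eq_rademacher_mean do rewrite quadE mulr_suml.
  rewrite rademacher_mean_sum; apply: eq_bigr => a _.
  under [LHS]eq_rademacher_mean do rewrite mulr_suml.
  rewrite rademacher_mean_sum; apply: eq_bigr => b _.
  by apply: eq_rademacher_mean => s; rewrite -mulrA.
under eq_bigr => a _.
  under eq_bigr do rewrite entryE.
  rewrite !big_split /= -big_mkcond big_pred1_eq; over.
rewrite !big_split sumrN /= -mulr_suml -sumrMnl.
have -> : \tr (X^T *m Y) = \sum_a \sum_b X a b * Y a b.
  rewrite exchange_big; apply: eq_bigr => b _; rewrite mxE.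
  by apply: eq_bigr => a _; rewrite mxE.
have -> : \tr (X *m Y) = \sum_a \sum_b X a b * Y b a.
  by apply: eq_bigr => a _; rewrite mxE.
by rewrite /mxtrace; ring.
Qed.

Lemma quad_var_le X :
  rademacher_mean (fun s => (quad X s - \tr X) ^+ 2) <= 2 * fro2 X.
Proof.
have -> : rademacher_mean (fun s => (quad X s - \tr X) ^+ 2)
    = fro2 X + \tr (X *m X) - (\sum_a X a a * X a a) *+ 2.
  transitivity (rademacher_mean (fun s =>
      quad X s * quad X s + (- 2 * \tr X * quad X s + \tr X ^+ 2))).
    by apply: eq_rademacher_mean => s; ring.
  rewrite !rademacher_meanD rademacher_meanZ rademacher_mean_cst.
  by rewrite rademacher_mean_quad rademacher_mean_quad_mul fro2E /gram; ring.
have : 0 <= \sum_a X a a * X a a by apply: sumr_ge0 => a _; rewrite -expr2 sqr_ge0.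
by have := mxtrace_sqr_le X; rewrite mulr2n; lra.
Qed.

End RademacherMoments.

Definition hutchinson_error (R : realType) (n q : nat) (X : 'M[R]_n)
    (G : 'M[R]_(n, q)) : R :=
  quad X G - q%:R * \tr X.

Section Hutchinson.
Variables (R : realType) (n : nat) (X : 'M[R]_n).

Lemma hutchinson_error_row_mx (s : 'cV[R]_n) (q : nat) (G : 'M[R]_(n, q)) :
  hutchinson_error X (row_mx s G) = (quad X s - \tr X) + hutchinson_error X G.
Proof. by rewrite /hutchinson_error quad_row_mx natrD; ring. Qed.

Lemma hutchinson_unbiased (q : nat) :
  rademacher_mean (fun G : 'M[R]_(n, q) => hutchinson_error X G) = 0.
Proof.
elim: q => [|q IHq].
  by rewrite rademacher_mean0 /hutchinson_error /quad mulmx0 mxtrace0 mul0r subrr.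
rewrite (@rademacher_mean_row_mx _ _ 1 q).
under eq_rademacher_mean => s.
  under eq_rademacher_mean do rewrite hutchinson_error_row_mx.
  rewrite rademacher_meanD rademacher_mean_cst IHq addr0; over.
by rewrite rademacher_meanD rademacher_mean_quad rademacher_mean_cst subrr.
Qed.

Lemma hutchinson_var_le (q : nat) :
  rademacher_mean (fun G : 'M[R]_(n, q) => hutchinson_error X G ^+ 2)
  <= q%:R * (2 * fro2 X).
Proof.
elim: q => [|q IHq].
  rewrite rademacher_mean0 /hutchinson_error /quad mulmx0 mxtrace0 !mul0r.
  by rewrite subrr expr0n.
rewrite (@rademacher_mean_row_mx _ _ 1 q).
under eq_rademacher_mean => s.
  under eq_rademacher_mean do rewrite hutchinson_error_row_mx sqrrD -mulrnAl.
  rewrite !rademacher_meanD rademacher_mean_cst rademacher_meanZ.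
  rewrite hutchinson_unbiased mulr0 addr0; over.
rewrite rademacher_meanD rademacher_mean_cst -natr1 mulrDl mul1r addrC lerD //.
exact: quad_var_le.
Qed.

End Hutchinson.

(** * Low-rank approximation by a Rademacher sketch *)

Section Deflation.
Variable R : realFieldType.
Variables m n : nat.

Definition deflate (C : 'M[R]_(m, n)) (s : 'cV[R]_n) : 'M[R]_(m, n) :=
  (1%:M - line_proj (C *m s)) *m C.

Fixpoint sketch_residual (q : nat) :
    'M[R]_(n, q) -> 'M[R]_(m, n) -> 'M[R]_(m, n) :=
  match q return 'M[R]_(n, q) -> 'M[R]_(m, n) -> 'M[R]_(m, n) with
  | 0 => fun _ C => C
  | q'.+1 => fun (S : 'M[R]_(n, 1 + q')) C =>
      sketch_residual (rsubmx S) (deflate C (lsubmx S))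
  end.

Lemma sketch_residual_row_mx (q : nat) (s : 'cV[R]_n) (G : 'M[R]_(n, q)) C :
  sketch_residual (row_mx s G : 'M_(n, 1 + q)) C = sketch_residual G (deflate C s).
Proof. by rewrite /= row_mxKl row_mxKr. Qed.

Lemma sketch_residualE (q : nat) (S : 'M[R]_(n, q)) C :
  exists X, sketch_residual S C = C - C *m S *m X.
Proof.
elim: q S C => [|q IHq] S C; first by exists 0; rewrite mulmx0 subr0.
rewrite -[S](@hsubmxK _ n 1 q) sketch_residual_row_mx.
move: (lsubmx _) (rsubmx _) => s {}S.
have [X ->] := IHq S (deflate C s).
pose w := (fro2 (C *m s))^-1 *: ((C *m s)^T *m C).
have -> : deflate C s = C - C *m s *m w.
  by rewrite /deflate mulmxBl mul1mx -scalemxAl -scalemxAr mulmxA.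
exists (col_mx (w - w *m S *m X) X).
rewrite (mul_mx_row C s S) (mul_row_col (C *m s)) mulmxBr !mulmxBl !mulmxA.
by rewrite !opprD !opprK !addrA [RHS]addrAC.
Qed.

Definition dominated (p : nat) (B : 'M[R]_(p, n)) (C : 'M[R]_(m, n)) : Prop :=
  forall v : 'cV[R]_n, fro2 (C *m v) <= fro2 (B *m v).

Lemma dominated_deflate (p : nat) (B : 'M[R]_(p, n)) C s :
  dominated B C -> dominated B (deflate C s).
Proof.
move=> domC v; apply: le_trans (domC v); rewrite -mulmxA.
exact/fro2_orthoproj_compl_le/orthoproj_line.
Qed.

(* The tangent bound [1 / y >= 2 t - t ^ 2 y] makes the ratio polynomial in [s]. *)
Lemma fro2_deflate_le (t : R) C s :
  fro2 (deflate C s) <= fro2 C + (- 2 * t * quad (gram (gram C)) s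
    + t ^+ 2 * (quad (gram (gram C)) s * quad (gram C) s)).
Proof.
have numE : fro2 ((C *m s)^T *m C) = quad (gram (gram C)) s.
  by rewrite -fro2_mul_quad -fro2_tr trmx_mul trmxK mulmxA.
rewrite fro2_orthoproj_compl; last exact: orthoproj_line.
rewrite fro2_line_proj_mul lerD2l -numE -fro2_mul_quad -subr_ge0.
have [->|y_neq0] := eqVneq (C *m s) 0.
  have /eqP -> : fro2 ((0 : 'cV[R]_m)^T *m C) == 0.
    by rewrite fro2_eq0 trmx0 mul0mx.
  by rewrite !mul0r !mulr0 !oppr0 !addr0.
set x := fro2 (_ *m C); set y := fro2 (C *m s).
have y_gt0 : 0 < y by rewrite fro2_gt0.
have -> : - 2 * t * x + t ^+ 2 * (x * y) - - (x / y) = x / y * (1 - t * y) ^+ 2.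
  by field; rewrite gt_eqF.
by rewrite mulr_ge0 ?sqr_ge0 // divr_ge0 ?fro2_ge0.
Qed.

End Deflation.

Lemma dominated_interpolation (R : realType) (m n : nat) (B : 'M[R]_n)
    (C : 'M[R]_(m, n)) :
  dominated B C -> fro2 C ^+ 3 <= nuclear_norm B ^+ 2 * fro2 (gram C).
Proof.
move=> domC; have [W [d [WW Wd]]] := spectral_theorem_real (tr_gram B).
have diagE k (X : 'M[R]_(k, n)) i :
    fro2 (X *m (row i W)^T) = (W *m gram X *m W^T) i i.
  by rewrite fro2_mul_quad conj_diagE.
pose e i := Num.sqrt (fro2 (C *m (row i W)^T)).
have e_ge0 i : 0 <= e i by exact: sqrtr_ge0.
have e2 i : e i ^+ 2 = (W *m gram C *m W^T) i i.
  by rewrite sqr_sqrtr ?fro2_ge0 // diagE.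
have -> : fro2 C = \sum_i e i ^+ 2.
  under eq_bigr do rewrite e2.
  by rewrite -/(mxtrace _) mxtrace_mulC mulmxA (mulmx1C WW) mul1mx fro2E.
apply: le_trans (sum_sqr_interpolation e_ge0) _; apply: ler_pM.
- exact: sqr_ge0.
- by apply: sumr_ge0 => i _; rewrite exprn_ge0.
- rewrite lerXn2r ?nnegrE ?nuclear_norm_ge0 ?sumr_ge0 // (nuclear_normE WW Wd).
  apply: ler_sum => i _; apply: ler_wsqrtr.
  by rewrite (le_trans (domC _)) // diagE Wd mxE eqxx.
rewrite -(fro2_conj_orthogonal (gram C) WW); apply: le_trans (sum_sqr_diag_le _).
by apply: ler_sum => i _; rewrite -e2 -exprM.
Qed.

Section DeflationMean.
Variables (R : realType) (m n : nat) (C : 'M[R]_(m, n)).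

Lemma rademacher_mean_gram_quad_mul :
  rademacher_mean (fun s : 'cV_n => quad (gram (gram C)) s * quad (gram C) s)
  <= 3 * (fro2 C * fro2 (gram C)).
Proof.
rewrite rademacher_mean_quad_mul tr_gram -!fro2E.
have : \tr (gram (gram C) *m gram C) <= fro2 C * fro2 (gram C).
  rewrite (le_trans _ (fro2_mul C (gram C))) // fro2E /gram.
  by rewrite !trmx_mul !trmxK !mulmxA.
have : 0 <= \sum_a gram (gram C) a a * gram C a a.
  by apply: sumr_ge0 => a _; rewrite mulr_ge0 ?gram_diag_ge0.
by rewrite mulr2n; lra.
Qed.

Lemma rademacher_mean_fro2_deflate :
  rademacher_mean (fun s => fro2 (deflate C s))
  <= fro2 C - fro2 (gram C) / (3 * fro2 C).
Proof.
pose t := (3 * fro2 C)^-1.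
apply: le_trans (rademacher_mean_le (fro2_deflate_le t C)) _.
rewrite !rademacher_meanD !rademacher_meanZ rademacher_mean_cst.
rewrite rademacher_mean_quad -fro2E lerD2l.
have := ler_wpM2l (sqr_ge0 t) rademacher_mean_gram_quad_mul.
have [C0|C_neq0] := eqVneq (fro2 C) 0.
  by rewrite /t C0 mulr0 invr0 expr0n !mul0r !mulr0 mul0r addr0 oppr0.
have -> : t ^+ 2 * (3 * (fro2 C * fro2 (gram C))) = t * fro2 (gram C).
  by rewrite /t; field.
by rewrite [fro2 (gram C) / _]mulrC -/t; lra.
Qed.

End DeflationMean.

Section HarmonicDecay.
Variable R : realFieldType.
Implicit Types k l x a : R.

(* The solution [1 / (1 / x + k)] at time [k] of [y' = - y ^ 2], [y(0) = x]. *)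
Definition harmonic_decay k x : R := x / (1 + k * x).

Lemma harmonic_decay_denom_gt0 k x : 0 <= k -> 0 <= x -> 0 < 1 + k * x.
Proof. by move=> k_ge0 x_ge0; rewrite ltr_pwDl ?mulr_ge0. Qed.

Lemma harmonic_decay_ge0 k x : 0 <= k -> 0 <= x -> 0 <= harmonic_decay k x.
Proof. by move=> *; rewrite divr_ge0 // ltW ?harmonic_decay_denom_gt0. Qed.

Lemma harmonic_decayD k l x : 0 <= k -> 0 <= l -> 0 <= x ->
  harmonic_decay k (harmonic_decay l x) = harmonic_decay (k + l) x.
Proof.
move=> k_ge0 l_ge0 x_ge0; have := harmonic_decay_denom_gt0 l_ge0 x_ge0.
have := harmonic_decay_denom_gt0 (addr_ge0 k_ge0 l_ge0) x_ge0.
rewrite /harmonic_decay => /gt_eqF kl_neq0 /gt_eqF l_neq0.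
by field; rewrite kl_neq0 l_neq0.
Qed.

Lemma harmonic_decay_ge_euler k x : 0 <= k -> 0 <= x ->
  x - k * x ^+ 2 <= harmonic_decay k x.
Proof.
move=> k_ge0 x_ge0; rewrite ler_pdivlMr ?harmonic_decay_denom_gt0 // -subr_ge0.
have -> : x - (x - k * x ^+ 2) * (1 + k * x) = k ^+ 2 * x ^+ 3 by ring.
by rewrite mulr_ge0 ?exprn_ge0.
Qed.

Lemma harmonic_decay_tangent k x a : 0 <= k -> 0 <= x -> 0 <= a ->
  harmonic_decay k x <= harmonic_decay k a + (1 + k * a) ^- 2 * (x - a).
Proof.
move=> k_ge0 x_ge0 a_ge0; have kx_gt0 := harmonic_decay_denom_gt0 k_ge0 x_ge0.
have ka_gt0 := harmonic_decay_denom_gt0 k_ge0 a_ge0.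
rewrite /harmonic_decay -subr_ge0.
have -> : a / (1 + k * a) + (1 + k * a) ^- 2 * (x - a) - x / (1 + k * x)
    = k * (x - a) ^+ 2 / ((1 + k * x) * (1 + k * a) ^+ 2).
  by field; rewrite !gt_eqF.
by rewrite divr_ge0 // mulr_ge0 ?sqr_ge0 // ltW.
Qed.

Lemma mul_harmonic_decay_le1 k x : 0 <= k -> 0 <= x -> k * harmonic_decay k x <= 1.
Proof.
move=> k_ge0 x_ge0; rewrite mulrA ler_pdivrMr ?harmonic_decay_denom_gt0 //.
by rewrite mul1r lerDr ler01.
Qed.

End HarmonicDecay.

Lemma rademacher_mean_harmonic_decay (R : realType) (n q : nat)
    (F : 'M[R]_(n, q) -> R) (k a : R) :
  0 <= k -> (forall S, 0 <= F S) -> 0 <= a -> rademacher_mean F <= a ->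
  rademacher_mean (fun S => harmonic_decay k (F S)) <= harmonic_decay k a.
Proof.
move=> k_ge0 F_ge0 a_ge0 Fa.
apply: le_trans (rademacher_mean_le
  (fun S => harmonic_decay_tangent k_ge0 (F_ge0 S) a_ge0)) _.
rewrite rademacher_meanD rademacher_mean_cst rademacher_meanZ.
rewrite rademacher_meanD rademacher_mean_cst gerDl mulr_ge0_le0 ?subr_le0 //.
by rewrite invr_ge0 sqr_ge0.
Qed.

Section SketchMean.
Variables (R : realType) (m n : nat) (B : 'M[R]_n).

Lemma deflate_mean_le_decay (k : R) (C : 'M[R]_(m, n)) :
  0 <= k -> 3 * nuclear_norm B ^+ 2 * k <= 1 -> dominated B C ->
  rademacher_mean (fun s => fro2 (deflate C s)) <= harmonic_decay k (fro2 C).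
Proof.
move=> k_ge0 kN domC; have f_ge0 := fro2_ge0 C.
apply: le_trans (harmonic_decay_ge_euler k_ge0 f_ge0).
apply: le_trans (rademacher_mean_fro2_deflate C) _; rewrite lerD2l lerN2.
have [->|C_neq0] := eqVneq (fro2 C) 0; first by rewrite expr0n !mulr0 invr0 mulr0.
have f_gt0 : 0 < fro2 C by rewrite lt_def C_neq0.
rewrite ler_pdivlMr ?mulr_gt0 //.
have -> : k * fro2 C ^+ 2 * (3 * fro2 C) = 3 * k * fro2 C ^+ 3 by ring.
apply: (@le_trans _ _ (3 * k * (nuclear_norm B ^+ 2 * fro2 (gram C)))).
  by rewrite ler_wpM2l ?mulr_ge0 ?dominated_interpolation.
by rewrite mulrA [3 * k * _]mulrAC ler_piMl ?fro2_ge0.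
Qed.

Lemma sketch_residual_mean_le_decay (k : R) (q : nat) (C : 'M[R]_(m, n)) :
  0 <= k -> 3 * nuclear_norm B ^+ 2 * k <= 1 -> dominated B C ->
  rademacher_mean (fun S : 'M[R]_(n, q) => fro2 (sketch_residual S C))
  <= harmonic_decay (q%:R * k) (fro2 C).
Proof.
move=> k_ge0 kN; elim: q C => [|q IHq] C domC.
  by rewrite rademacher_mean0 /harmonic_decay !mul0r addr0 divr1.
have qk_ge0 : 0 <= q%:R * k by rewrite mulr_ge0.
rewrite (@rademacher_mean_row_mx _ _ 1 q) -natr1 mulrDl mul1r.
rewrite -harmonic_decayD ?fro2_ge0 //.
apply: (@le_trans _ _ (rademacher_mean (fun s =>
    harmonic_decay (q%:R * k) (fro2 (deflate C s))))).
  apply: rademacher_mean_le => s.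
  under eq_rademacher_mean do rewrite sketch_residual_row_mx.
  exact/IHq/dominated_deflate.
apply: rademacher_mean_harmonic_decay => //.
- by move=> s; exact: fro2_ge0.
- by rewrite harmonic_decay_ge0 ?fro2_ge0.
exact: deflate_mean_le_decay.
Qed.

End SketchMean.

Lemma sketch_residual_mean_le (R : realType) (n q : nat) (B : 'M[R]_n) :
  q%:R * rademacher_mean (fun S : 'M[R]_(n, q) => fro2 (sketch_residual S B))
  <= 3 * nuclear_norm B ^+ 2.
Proof.
apply/ler_addgt0Pr => e e_gt0; set D := _ + e.
have D_gt0 : 0 < D by rewrite ltr_wpDl // mulr_ge0 ?sqr_ge0.
have Dinv_ge0 : 0 <= D^-1 by rewrite invr_ge0 ltW.
rewrite -[leRHS]mul1r -ler_pdivrMr // mulrAC.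
have decay := mul_harmonic_decay_le1 (mulr_ge0 (ler0n R q) Dinv_ge0) (fro2_ge0 B).
apply: le_trans decay; rewrite ler_wpM2l ?mulr_ge0 //.
apply: (@sketch_residual_mean_le_decay _ _ _ B) => //.
by rewrite ler_pdivrMr // mul1r lerDl ltW.
Qed.

(** * The Hutch++ estimator *)

Section HutchppValue.
Variables (R : realType) (n : nat).

Lemma fro2_projected_residual_le (q p : nat) (B : 'M[R]_n) (S : 'M[R]_(n, q))
    (Q : 'M[R]_(n, p)) :
  Q^T *m Q = 1%:M -> (Q^T :=: (B *m S)^T)%MS ->
  fro2 ((1%:M - Q *m Q^T) *m B *m (1%:M - Q *m Q^T)) <= fro2 (sketch_residual S B).
Proof.
move=> QQ QY; have projQ := orthoproj_frame QQ.
have [complT _] := orthoproj_compl projQ.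
rewrite -fro2_tr trmx_mul complT.
apply: le_trans (fro2_orthoproj_compl_le _ projQ) _; rewrite fro2_tr.
have [X ->] := sketch_residualE S B.
have /submxP[D YD] : ((B *m S)^T <= Q^T)%MS by rewrite QY.
have Q_BS : (1%:M - Q *m Q^T) *m (B *m S) = 0.
  rewrite -[B *m S]trmxK YD trmx_mul trmxK mulmxBl mul1mx mulmxA -(mulmxA Q) QQ.
  by rewrite mulmx1 subrr.
have -> : (1%:M - Q *m Q^T) *m B = (1%:M - Q *m Q^T) *m (B - B *m S *m X).
  by rewrite [RHS]mulmxBr [_ *m (_ *m X)]mulmxA Q_BS mul0mx subr0.
exact: fro2_orthoproj_compl_le.
Qed.

Variables (orth : orthonormalizer R n) (l : nat).
Hypothesis orthP : orthonormalizes orth.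
Hypotheses (l_gt0 : (0 < l)%N) (dvd3_l : (3 %| l)%N).
Local Notation q := (l %/ 3)%N.

Let q_neq0 : q%:R != 0 :> R.
Proof. by rewrite pnatr_eq0 -lt0n divn_gt0 // dvdn_leq. Qed.

Let lE : l%:R = 3 * q%:R :> R.
Proof. by rewrite -natrM mulnC divnK. Qed.

(* Since [1 - Q Q^T] is idempotent, the two traces add up to [\tr B]. *)
Lemma hutchpp_value_error (B : 'M[R]_n) (S G : 'M[R]_(n, q)) :
  let P := 1%:M - orth (B *m S) *m (orth (B *m S))^T in
  hutchpp_value orth B S G - \tr B = q%:R^-1 * hutchinson_error (P *m B *m P) G.
Proof.
move=> P; have [QQ _] := orthP (B *m S).
have [_ PP] := orthoproj_compl (orthoproj_frame QQ); rewrite -/P in PP.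
rewrite /hutchpp_value -/P; set Q := orth (B *m S) in P QQ PP *.
have trB : \tr B = \tr (Q^T *m B *m Q) + \tr (P *m B *m P).
  rewrite [\tr (P *m B *m P)]mxtrace_mulC mulmxA PP mulmxBl mul1mx raddfB /=.
  by rewrite [\tr (_ *m B *m Q)]mxtrace_mulC mulmxA addrC subrK.
have -> : 3 / l%:R = q%:R^-1 :> R by rewrite lE; field.
by rewrite trB /hutchinson_error /quad mulrBr mulKf // !mulmxA; ring.
Qed.

Lemma hutchpp_value_unbiased (B : 'M[R]_n) :
  rademacher_mean (fun S => rademacher_mean (fun G =>
    @hutchpp_value R n orth l B S G - \tr B)) = 0.
Proof.
rewrite -[RHS](@rademacher_mean_cst R n q); apply: eq_rademacher_mean => S.
under eq_rademacher_mean do rewrite hutchpp_value_error.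
by rewrite rademacher_meanZ hutchinson_unbiased mulr0.
Qed.

Lemma hutchpp_value_cond_var_le (B : 'M[R]_n) (S : 'M[R]_(n, q)) :
  rademacher_mean (fun G => (hutchpp_value orth B S G - \tr B) ^+ 2)
  <= 2 / q%:R * fro2 (sketch_residual S B).
Proof.
under eq_rademacher_mean do rewrite hutchpp_value_error exprMn.
rewrite rademacher_meanZ; set Z := _ *m B *m _.
have var := ler_wpM2l (sqr_ge0 q%:R^-1) (hutchinson_var_le Z q).
apply: le_trans var _.
have -> : q%:R^-1 ^+ 2 * (q%:R * (2 * fro2 Z)) = 2 / q%:R * fro2 Z by field.
rewrite ler_wpM2l ?divr_ge0 ?ler0n //.
by have [QQ QY] := orthP (B *m S); exact: fro2_projected_residual_le.
Qed.

Lemma hutchpp_value_var_le (B : 'M[R]_n) :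
  rademacher_mean (fun S => rademacher_mean (fun G =>
    (@hutchpp_value R n orth l B S G - \tr B) ^+ 2))
  <= 54 * nuclear_norm B ^+ 2 / l%:R ^+ 2.
Proof.
apply: le_trans (rademacher_mean_le (hutchpp_value_cond_var_le B)) _.
rewrite rademacher_meanZ lE.
have -> : 54 * nuclear_norm B ^+ 2 / (3 * q%:R) ^+ 2
    = 2 / q%:R ^+ 2 * (3 * nuclear_norm B ^+ 2) by field.
set x := rademacher_mean _.
have -> : 2 / q%:R * x = 2 / q%:R ^+ 2 * (q%:R * x) by field.
by rewrite ler_wpM2l ?sketch_residual_mean_le // divr_ge0 ?sqr_ge0.
Qed.

End HutchppValue.

(** * Expected values of randomized algorithms *)

Fixpoint expect (R : realType) (n : nat) (X : Type) (A : nat -> 'M[R]_n)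
    (p : alg R n X) (F : X -> R) {struct p} : R :=
  match p with
  | Ret x => F x
  | Rademacher q k => rademacher_mean (fun S => expect A (k S) F)
  | MatVec i v k => expect A (k (A i *m v)) F
  end.

Section Expect.
Variables (R : realType) (n : nat) (A : nat -> 'M[R]_n).
Implicit Types X Y : Type.

Lemma Pr_expect X (p : alg R n X) (E : X -> bool) :
  Pr A p E = expect A p (fun x => (E x)%:R).
Proof.
elim: p => [x|q k IH|i v k IH] //=.
by congr (_ / _); apply: eq_bigr => S _; rewrite IH.
Qed.

Lemma expect_bind X Y (p : alg R n X) (f : X -> alg R n Y) F :
  expect A (bind p f) F = expect A p (fun x => expect A (f x) F).
Proof. by elim: p => [x|q k IH|i v k IH] //=; apply: eq_rademacher_mean. Qed.

Lemma expect_le X (p : alg R n X) (F G : X -> R) :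
  (forall x, F x <= G x) -> expect A p F <= expect A p G.
Proof.
by move=> FG; elim: p => [x|q k IH|i v k IH] //=; apply: rademacher_mean_le.
Qed.

Lemma eq_expect X (p : alg R n X) (F G : X -> R) :
  F =1 G -> expect A p F = expect A p G.
Proof.
by move=> FG; elim: p => [x|q k IH|i v k IH] //=; apply: eq_rademacher_mean.
Qed.

Lemma expectD X (p : alg R n X) (F G : X -> R) :
  expect A p (fun x => F x + G x) = expect A p F + expect A p G.
Proof.
elim: p => [x|q k IH|i v k IH] //=.
by rewrite -rademacher_meanD; apply: eq_rademacher_mean.
Qed.

Lemma expectZ X (p : alg R n X) (c : R) (F : X -> R) :
  expect A p (fun x => c * F x) = c * expect A p F.
Proof.
elim: p => [x|q k IH|i v k IH] //=.
by rewrite -rademacher_meanZ; apply: eq_rademacher_mean.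
Qed.

Lemma expect_cst X (p : alg R n X) (c : R) : expect A p (fun=> c) = c.
Proof.
elim: p => [x|q k IH|i v k IH] //=.
by rewrite -[RHS](@rademacher_mean_cst R n q); apply: eq_rademacher_mean.
Qed.

Lemma expect_ge0 X (p : alg R n X) (F : X -> R) :
  (forall x, 0 <= F x) -> 0 <= expect A p F.
Proof. by move=> F_ge0; rewrite -(expect_cst p 0); apply: expect_le. Qed.

Lemma expect_sqr_affine_le X (p : alg R n X) (g : X -> R) (u c v : R) :
  expect A p g = 0 -> expect A p (fun x => g x ^+ 2) <= v ->
  expect A p (fun x => (u + c * g x) ^+ 2) <= u ^+ 2 + c ^+ 2 * v.
Proof.
move=> g0 gv; rewrite (@eq_expect _ _ _ (fun x =>
  u ^+ 2 + (2 * u * c * g x + c ^+ 2 * g x ^+ 2))) => [|x]; last by ring.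
rewrite !expectD !expectZ expect_cst g0 mulr0 add0r lerD2l.
by rewrite ler_wpM2l // sqr_ge0.
Qed.

Lemma chebyshev X (p : alg R n X) (F : X -> R) (eps : R) : 0 < eps ->
  Pr A p (fun x => eps <= `|F x|) <= expect A p (fun x => F x ^+ 2) / eps ^+ 2.
Proof.
move=> eps_gt0; rewrite Pr_expect mulrC -expectZ.
apply: expect_le => x; rewrite mulrC ler_pdivlMr ?exprn_gt0 //.
have [eps_le|_] := boolP (_ <= `|_|); last by rewrite mul0r sqr_ge0.
by rewrite mul1r -[leRHS]real_normK ?num_real // lerXn2r ?nnegrE // ltW.
Qed.

Lemma expect_sum_values X (p : alg R n X) (F : X -> R) :
  exists s : seq R, forall t, uniq t -> {subset s <= t} ->
    expect A p F = \sum_(c <- t) c * Pr A p (fun x => F x == c).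
Proof.
elim: p => [x|q k IH|i v k IH] /=; last exact: IH.
  exists [:: F x] => t t_uniq /(_ _ (mem_head _ _)) Fx_t.
  rewrite (bigD1_seq (F x)) //= eqxx mulr1 big1 ?addr0 // => c /negbTE.
  by rewrite eq_sym => ->; rewrite mulr0.
have /fin_all_exists[s sP] := fun S : 'M[bool]_(n, q) => IH (sign_mx R S).
exists (flatten [seq s Z | Z : 'M[bool]_(n, q)]) => t t_uniq s_t.
under [RHS]eq_bigr do rewrite mulrA mulr_sumr.
rewrite -mulr_suml exchange_big; congr (_ / _); apply: eq_bigr => S _.
apply: sP => // c cS; apply/s_t/flatten_mapP; exists S => //.
by rewrite mem_enum.
Qed.

Lemma eq_law_expect X (p p' : alg R n X) (F : X -> R) :
  (forall E, Pr A p E = Pr A p' E) -> expect A p F = expect A p' F.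
Proof.
move=> law; have [s sP] := expect_sum_values p F.
have [s' sP'] := expect_sum_values p' F.
pose t := undup (s ++ s'); have t_uniq : uniq t by exact: undup_uniq.
have st : {subset s <= t} by move=> c cs; rewrite mem_undup mem_cat cs.
have s't : {subset s' <= t} by move=> c cs'; rewrite mem_undup mem_cat cs' orbT.
rewrite (sP t) // (sP' t) //.
by apply: eq_bigr => c _; rewrite law.
Qed.

Lemma num_matvec_bind X Y (p : alg R n X) (f : X -> alg R n Y) (c : nat) :
  (forall x, num_matvec A (f x) <= c)%N ->
  (num_matvec A (bind p f) <= num_matvec A p + c)%N.
Proof.
move=> fc; elim: p => [x|q k IH|i v k IH] //=; last by rewrite addSn ltnS.
apply/bigmax_leqP => S _; apply: leq_trans (IH _) _; rewrite leq_add2r.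
exact: (leq_bigmax S).
Qed.

End Expect.

Section ExpectHutchpp.
Variables (R : realType) (n : nat) (A : nat -> 'M[R]_n).
Variables (orth : orthonormalizer R n) (l : nat).
Variables (o : oracle R n) (B : 'M[R]_n) (d : nat).
Hypothesis oB : computes A o B d.

Lemma expect_hutchpp (F : R -> R) :
  expect A (hutchpp orth l o) F =
  rademacher_mean (fun S => rademacher_mean (fun G =>
    F (@hutchpp_value R n orth l B S G))).
Proof.
exact: (@eq_law_expect _ _ _ _ _ (Rademacher _ (fun S => Rademacher _ (fun G =>
  Ret (hutchpp_value orth B S G))))) (hutchppP orth l oB).1.
Qed.

Hypothesis orthP : orthonormalizes orth.
Hypotheses (l_gt0 : (0 < l)%N) (dvd3_l : (3 %| l)%N).

Lemma hutchpp_unbiased : expect A (hutchpp orth l o) (fun t => t - \tr B) = 0.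
Proof. by rewrite expect_hutchpp hutchpp_value_unbiased. Qed.

Lemma hutchpp_var_le :
  expect A (hutchpp orth l o) (fun t => (t - \tr B) ^+ 2)
  <= 54 * nuclear_norm B ^+ 2 / l%:R ^+ 2.
Proof. by rewrite expect_hutchpp hutchpp_value_var_le. Qed.

End ExpectHutchpp.

(** * DeltaShift++ *)

Section DeltaShift.
Variables (R : realType) (n : nat) (A : nat -> 'M[R]_n).
Variables (orth : orthonormalizer R n) (l0 l : nat) (gamma : R).
Local Notation run := (deltashiftpp orth l0 l gamma).

Lemma expect_deltashiftpp1 F :
  expect A (run 1) F = expect A (hutchpp orth l0 (orc 1)) (fun t => F [:: t]).
Proof. exact: expect_bind. Qed.

Lemma expect_deltashiftppS (m : nat) F :
  expect A (run m.+2) F = expect A (run m.+1) (fun ts =>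
    expect A (hutchpp orth l (orc m.+2)) (fun a =>
    expect A (hutchpp orth l (orc_diff m.+2 m.+1)) (fun b =>
      F (rcons ts (gamma * a + (1 - gamma) * (last 0 ts + b)))))).
Proof.
rewrite [LHS]expect_bind; apply: eq_expect => ts.
by rewrite expect_bind; apply: eq_expect => a; rewrite expect_bind.
Qed.

Lemma eq_expect_deltashiftpp (m : nat) (F G : seq R -> R) :
  (forall ts, size ts = m -> F ts = G ts) ->
  expect A (run m) F = expect A (run m) G.
Proof.
elim: m F G => [|[|m] IHm] F G FG; first exact: FG.
  by rewrite !expect_deltashiftpp1; apply: eq_expect => t; exact: FG.
rewrite !expect_deltashiftppS; apply: IHm => ts ts_m.
by do 2 (apply: eq_expect => ?); rewrite FG // size_rcons ts_m.
Qed.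

Lemma expect_deltashiftpp_nth (m i : nat) (F : R -> R) : (1 <= i <= m)%N ->
  expect A (run m) (fun ts => F (nth 0 ts i.-1)) =
  expect A (run i) (fun ts => F (last 0 ts)).
Proof.
case/andP; elim: m => [|m IHm] i_gt0; first by rewrite leqNgt i_gt0.
rewrite leq_eqVlt => /predU1P[->|im].
  by apply: eq_expect_deltashiftpp => ts ts_m; rewrite -nth_last ts_m.
case: m im IHm => [|m] im IHm; first by rewrite ltnS leqNgt i_gt0 in im.
rewrite -IHm // expect_deltashiftppS; apply: eq_expect_deltashiftpp => ts ts_m.
under eq_expect => a.
  under eq_expect => b do rewrite nth_rcons ts_m prednK // -ltnS im.
  rewrite expect_cst; over.
exact: expect_cst.
Qed.

Lemma num_matvec_deltashiftpp (m : nat) :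
  (num_matvec A (run m) <= l0 + m * (3 * l))%N.
Proof.
have hutchpp_ret k (o : oracle R n) B d (f : R -> seq R) : computes A o B d ->
    (num_matvec A (let* t := hutchpp orth k o in Ret (f t)) <= k * d)%N.
  move=> oB; apply: leq_trans (hutchppP orth k oB).2.
  by rewrite -[leqRHS]addn0; apply: num_matvec_bind.
elim: m => [|[|m] IHm] //.
  apply: leq_trans (hutchpp_ret _ _ _ _ _ (computes_orc A 1)) _.
  by rewrite muln1 leq_addr.
rewrite mulSn addnCA; apply: leq_trans (num_matvec_bind (c := (3 * l)%N) _ _) _.
  move=> ts; apply: leq_trans (num_matvec_bind (c := (l * 2)%N) _ _) _ => [a|].
    exact: hutchpp_ret (computes_orc_diff A m.+2 m.+1).
  rewrite [(3 * l)%N]mulnC (mulnDr l 1 2) leq_add2r.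
  exact: (hutchppP orth l (computes_orc A m.+2)).2.
by rewrite addnC leq_add2l.
Qed.

Definition deltashiftpp_mse (j : nat) : R :=
  expect A (run j) (fun ts => (last 0 ts - \tr (A j)) ^+ 2).

Lemma deltashiftpp_mse_ge0 (j : nat) : 0 <= deltashiftpp_mse j.
Proof. by apply: expect_ge0 => ts; exact: sqr_ge0. Qed.

Hypothesis orthP : orthonormalizes orth.
Hypotheses (l0_gt0 : (0 < l0)%N) (dvd3_l0 : (3 %| l0)%N).
Hypotheses (l_gt0 : (0 < l)%N) (dvd3_l : (3 %| l)%N).

Lemma deltashiftpp_mse1 :
  deltashiftpp_mse 1 <= 54 * nuclear_norm (A 1) ^+ 2 / l0%:R ^+ 2.
Proof.
rewrite /deltashiftpp_mse expect_deltashiftpp1.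
exact: (hutchpp_var_le (computes_orc A 1)).
Qed.

(* The new error is [(1 - gamma) x + gamma a' + (1 - gamma) b'], where [x] is the
   previous error and [a'], [b'] are independent centered errors. *)
Lemma deltashiftpp_mseS (j : nat) :
  deltashiftpp_mse j.+2 <= (1 - gamma) ^+ 2 * deltashiftpp_mse j.+1
    + (gamma ^+ 2 * (54 * nuclear_norm (A j.+2) ^+ 2 / l%:R ^+ 2)
    + (1 - gamma) ^+ 2 * (54 * nuclear_norm (A j.+2 - A j.+1) ^+ 2 / l%:R ^+ 2)).
Proof.
have oa := computes_orc A j.+2; have ob := computes_orc_diff A j.+2 j.+1.
rewrite /deltashiftpp_mse expect_deltashiftppS -expectZ.
rewrite -[X in _ <= _ + X](expect_cst A (run j.+1)) -expectD.
apply: expect_le => ts; set x := last 0 ts - \tr (A j.+1).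
set vb := 54 * nuclear_norm (A j.+2 - A j.+1) ^+ 2 / _.
apply: (@le_trans _ _ (expect A (hutchpp orth l (orc j.+2)) (fun a =>
   ((1 - gamma) * x + gamma * (a - \tr (A j.+2))) ^+ 2 + (1 - gamma) ^+ 2 * vb))).
  apply: expect_le => a.
  have unb := hutchpp_unbiased ob orthP l_gt0 dvd3_l.
  apply: le_trans (expect_sqr_affine_le _ _ unb (hutchpp_var_le ob orthP l_gt0 dvd3_l)).
  rewrite le_eqVlt; apply/predU1P; left; apply: eq_expect => b.
  by rewrite last_rcons /x raddfB /=; ring.
rewrite expectD expect_cst addrA lerD2r -exprMn.
exact: expect_sqr_affine_le (hutchpp_unbiased oa _ _ _) (hutchpp_var_le oa _ _ _).
Qed.

End DeltaShift.

Lemma damped_recursion_le (R : realDomainType) (gamma v w x : R) :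
  0 <= gamma <= 1 -> 0 <= x <= v -> 0 <= w -> 2 * gamma * w <= v ->
  (1 - gamma) ^+ 2 * x + (gamma ^+ 2 * w + (1 - gamma) ^+ 2 * (gamma ^+ 2 * w)) <= v.
Proof.
move=> /andP[g_ge0 g_le1] /andP[x_ge0 xv] w_ge0 wv.
have damping : (1 - gamma) ^+ 2 <= 1 - gamma.
  by rewrite expr2 ler_piMl ?subr_ge0 // lerBlDr lerDl.
have old : (1 - gamma) ^+ 2 * x <= (1 - gamma) * v.
  by apply: ler_pM => //; exact: sqr_ge0.
have new : (1 - gamma) ^+ 2 * (gamma ^+ 2 * w) <= gamma ^+ 2 * w.
  rewrite ler_piMl ?mulr_ge0 ?sqr_ge0 // (le_trans damping) //.
  by rewrite lerBlDr lerDl.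
have := ler_wpM2l g_ge0 wv.
have -> : gamma * (2 * gamma * w) = 2 * (gamma ^+ 2 * w) by ring.
by lra.
Qed.

Section DeltaShiftGuarantee.
Variables (R : realType) (n : nat) (A : nat -> 'M[R]_n).
Variables (orth : orthonormalizer R n) (l0 l m : nat) (gamma v : R).
Hypothesis orthP : orthonormalizes orth.
Hypotheses (l0_gt0 : (0 < l0)%N) (dvd3_l0 : (3 %| l0)%N).
Hypotheses (l_gt0 : (0 < l)%N) (dvd3_l : (3 %| l)%N).
Hypothesis gamma_itv : 0 <= gamma <= 1.
Hypothesis A_le : forall i, (1 <= i <= m)%N -> nuclear_norm (A i) <= 1.
Hypothesis diff_le :
  forall i, (1 <= i < m)%N -> nuclear_norm (A i.+1 - A i) <= gamma.
Hypothesis l0_budget : 54 / l0%:R ^+ 2 <= v.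
Hypothesis l_budget : 2 * gamma * (54 / l%:R ^+ 2) <= v.

Lemma deltashiftpp_mse_le (j : nat) : (1 <= j <= m)%N ->
  deltashiftpp_mse A orth l0 l gamma j <= v.
Proof.
have var_le (k : nat) (B : 'M[R]_n) b : nuclear_norm B <= b ->
    54 * nuclear_norm B ^+ 2 / k%:R ^+ 2 <= b ^+ 2 * (54 / k%:R ^+ 2).
  move=> Bb; rewrite [54 * _]mulrC -mulrA ler_wpM2r ?divr_ge0 ?sqr_ge0 //.
  by rewrite lerXn2r ?nnegrE ?nuclear_norm_ge0 // (le_trans (nuclear_norm_ge0 B)).
case: j => // j; elim: j => [|j IHj] jm.
  apply: le_trans (deltashiftpp_mse1 _ _ _ orthP l0_gt0 dvd3_l0) _.
  by apply: le_trans (var_le _ _ _ (A_le jm)) _; rewrite expr1n mul1r.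
apply: le_trans (deltashiftpp_mseS _ _ _ orthP l_gt0 dvd3_l j) _.
have w_ge0 : 0 <= 54 / l%:R ^+ 2 :> R by rewrite divr_ge0 ?sqr_ge0.
have x_itv : 0 <= deltashiftpp_mse A orth l0 l gamma j.+1 <= v.
  by rewrite deltashiftpp_mse_ge0 (IHj (ltnW jm)).
apply: le_trans (damped_recursion_le gamma_itv x_itv w_ge0 l_budget).
rewrite lerD2l lerD // ler_wpM2l ?sqr_ge0 //.
  by rewrite (le_trans (var_le _ _ _ (A_le jm))) // expr1n mul1r.
exact/var_le/diff_le.
Qed.

Lemma deltashiftpp_tail (eps : R) (i : nat) : 0 < eps -> (1 <= i <= m)%N ->
  Pr A (deltashiftpp orth l0 l gamma m)
    (fun ts => eps <= `|nth 0 ts i.-1 - \tr (A i)|) <= v / eps ^+ 2.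
Proof.
move=> eps_gt0 i_m; apply: le_trans (chebyshev _ _ _ eps_gt0) _.
rewrite (expect_deltashiftpp_nth _ _ _ _ _ (fun t => (t - \tr (A i)) ^+ 2)) //.
by rewrite ler_wpM2r ?invr_ge0 ?sqr_ge0 // deltashiftpp_mse_le.
Qed.

End DeltaShiftGuarantee.

Section SampleSize.
Variable R : realType.
Implicit Types z c eps delta : R.

Lemma dvdn3_sample_size z : (3 %| sample_size z)%N.
Proof. exact: dvdn_mulr. Qed.

Lemma sample_size_gt0 z : 0 < z -> (0 < sample_size z)%N.
Proof. by move=> z_gt0; rewrite muln_gt0 absz_gt0 gt_eqF // ceil_gt0. Qed.

Lemma sample_sizeE z : 0 <= z -> (sample_size z)%:R = 3 * (Num.ceil z)%:~R :> R.
Proof.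
move=> z_ge0; rewrite natrM natr_absz ger0_norm //.
by rewrite ceil_ge0 (lt_le_trans (ltrN10 R)).
Qed.

Lemma sample_size_ge z : 0 <= z -> 3 * z <= (sample_size z)%:R.
Proof. by move=> z_ge0; rewrite sample_sizeE // ler_pM2l // ceil_ge. Qed.

Lemma sample_size_le z : 0 <= z -> (sample_size z)%:R <= 3 * z + 3.
Proof.
move=> z_ge0; rewrite sample_sizeE //; have := ceilB1_lt z; rewrite intrB.
by lra.
Qed.

Lemma sample_size_budget c z eps delta : 0 < c -> 0 < z -> 0 < eps -> 0 < delta ->
  (3 * c) ^+ 2 * z / (sample_size (c * (Num.sqrt (z / delta) / eps)))%:R ^+ 2
  <= eps ^+ 2 * delta.
Proof.
move=> c_gt0 z_gt0 eps_gt0 delta_gt0; set y := c * _; set l := sample_size y.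
have y_gt0 : 0 < y by rewrite mulr_gt0 // divr_gt0 // sqrtr_gt0 divr_gt0.
have l_gt0 : 0 < l%:R :> R by rewrite ltr0n sample_size_gt0.
have zE : (3 * c) ^+ 2 * z = eps ^+ 2 * delta * (3 * y) ^+ 2.
  rewrite /y !exprMn exprVn sqr_sqrtr; last by rewrite ltW // divr_gt0.
  by field; rewrite !gt_eqF.
rewrite zE ler_pdivrMr ?exprn_gt0 // ler_wpM2l //.
  by rewrite mulr_ge0 ?sqr_ge0 // ltW.
have y3_ge0 : 0 <= 3 * y by rewrite mulr_ge0 // ltW.
by rewrite lerXn2r ?nnegrE ?ler0n // sample_size_ge // ltW.
Qed.

End SampleSize.

Lemma num_matvec_deltashiftpp_sample_size (R : realType) (n m : nat)
    (A : nat -> 'M[R]_n) (orth : orthonormalizer R n) (gamma c x y : R) :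
  0 <= c -> 0 <= x -> 1 <= y ->
  (num_matvec A (deltashiftpp orth (sample_size (c * y)) (sample_size (c * x))
    gamma m))%:R <= 9 * (c + 1) * (m%:R * Num.max 1 x + y).
Proof.
move=> c_ge0 x_ge0 y_ge1; set l0 := sample_size _; set l := sample_size _.
have y_ge0 : 0 <= y by exact: le_trans y_ge1.
have M_ge1 : 1 <= Num.max 1 x by rewrite le_max lexx.
have cx_le : c * x <= c * Num.max 1 x by rewrite ler_wpM2l // le_max lexx orbT.
have l0_le : l0%:R <= 9 * (c + 1) * y.
  have := sample_size_le (mulr_ge0 c_ge0 y_ge0); rewrite -/l0.
  by have := mulr_ge0 c_ge0 y_ge0; lra.
have l_le : 3 * l%:R <= 9 * (c + 1) * Num.max 1 x.
  by have := sample_size_le (mulr_ge0 c_ge0 x_ge0); rewrite -/l; lra.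
apply: (@le_trans _ _ (l0 + m * (3 * l))%:R).
  by rewrite ler_nat; exact: num_matvec_deltashiftpp.
rewrite natrD (natrM _ m) (natrM _ 3); have := ler_wpM2l (ler0n R m) l_le.
by lra.
Qed.

Theorem theorem2 (R : realType) :
  exists c0 c K : R,
    [/\ 0 < c0, 0 < c & 0 < K] /\
    forall (eps delta alpha : R),
      0 < eps < 1 -> 0 < delta < 1 -> 0 < alpha < 1 ->
      let y := Num.sqrt (1 / delta) / eps in
      let x := Num.sqrt (alpha / delta) / eps in
      let l0 := sample_size (c0 * y) in
      let l := sample_size (c * x) in
      forall (n m : nat) (A : nat -> 'M[R]_n) (orth : orthonormalizer R n),
        orthonormalizes orth ->
        (forall i, (1 <= i <= m)%N -> nuclear_norm (A i) <= 1) ->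
        (forall i, (1 <= i < m)%N -> nuclear_norm (A i.+1 - A i) <= alpha) ->
        (forall i, (1 <= i <= m)%N ->
           Pr A (deltashiftpp orth l0 l alpha m)
             (fun ts => eps <= `|nth 0 ts i.-1 - \tr (A i)|) <= delta) /\
        (num_matvec A (deltashiftpp orth l0 l alpha m))%:R
          <= K * (m%:R * Num.max 1 x + y).
Proof.
exists 4, 4, (9 * (4 + 1)); split; first by split; rewrite ?mulr_gt0 ?addr_gt0.
move=> eps delta alpha /andP[e_gt0 e_lt1] /andP[d_gt0 d_lt1] /andP[a_gt0 a_lt1].
move=> y x l0 l n m A orth orthP A_le diff_le.
have y_ge1 : 1 <= y.
  rewrite ler_pdivlMr // !mul1r (le_trans (ltW e_lt1)) //.
  by rewrite -sqrtr1 ler_wsqrtr // invf_ge1 // ltW.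
have x_gt0 : 0 < x by rewrite divr_gt0 // sqrtr_gt0 divr_gt0.
split=> [i i_m|]; last exact: num_matvec_deltashiftpp_sample_size (ltW x_gt0) y_ge1.
rewrite -(mulfK (lt0r_neq0 (exprn_gt0 2 e_gt0)) delta) [delta * _]mulrC.
apply: deltashiftpp_tail i_m; rewrite ?dvdn3_sample_size //.
- by rewrite sample_size_gt0 // mulr_gt0 // (lt_le_trans ltr01).
- by rewrite sample_size_gt0 // mulr_gt0.
- by rewrite !ltW.
- apply: le_trans (sample_size_budget (ltr0Sn R 3) ltr01 e_gt0 d_gt0).
  by rewrite ler_wpM2r ?invr_ge0 ?sqr_ge0 // mulr1; lra.
apply: le_trans (sample_size_budget (ltr0Sn R 3) a_gt0 e_gt0 d_gt0).
by rewrite mulrA ler_wpM2r ?invr_ge0 ?sqr_ge0 //; lra.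
Qed.
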